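(* The group cohomology of the binary tetrahedral group $\mathcal{T}$ with (trivial) integer coefficients is, for $q\ge0$, $$H^q(\mathcal{T},\mathbb{Z})\cong\begin{cases}\mathbb{Z}&\text{if }q=0,\\ \mathbb{Z}/24\mathbb{Z}&\text{if }q>0\text{ and }q\equiv0\pmod4,\\ \mathbb{Z}/3\mathbb{Z}&\text{if }q\equiv2\pmod4,\\0&\text{otherwise.}\end{cases}$$
   Context: $\mathcal{T}$ is the subgroup of order 24 of the group of unit quaternions generated by $i$ and $\frac12(-1+i+j+k)$. *)

(* Defs.v *)
From HB Require Import structures.
From mathcomp Require Import all_boot all_order all_algebra ring zify.
From mathcomp Require Import boolp classical_sets functions reals.

Set Implicit Arguments.
Unset Strict Implicit.
Unset Printing Implicit Defensive.

Import Order.TTheory GRing.Theory Num.Theory.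
Local Open Scope ring_scope.

(* Hamilton's quaternions: Quat a b c d is a + b i + c j + d k. *)
Record quaternion (R : Type) := Quat { qre : R; qi : R; qj : R; qk : R }.

Section Quaternion.
Variable R : realType.
Implicit Types x y z : quaternion R.

Definition quat_to x := (qre x, qi x, qj x, qk x).
Definition quat_of (p : R * R * R * R) :=
  Quat p.1.1.1 p.1.1.2 p.1.2 p.2.
Lemma quat_toK : cancel quat_to quat_of. Proof. by case. Qed.
HB.instance Definition _ := Choice.copy (quaternion R) (can_type quat_toK).

Definition qone : quaternion R := Quat 1 0 0 0.

Definition qmul x y : quaternion R :=
  let: Quat a b c d := x in let: Quat a' b' c' d' := y in
  Quat (a * a' - b * b' - c * c' - d * d')
       (a * b' + b * a' + c * d' - d * c')
       (a * c' - b * d' + c * a' + d * b')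
       (a * d' + b * c' - c * b' + d * a').

Definition qconj x : quaternion R :=
  let: Quat a b c d := x in Quat a (- b) (- c) (- d).

Definition qnorm2 x : R :=
  let: Quat a b c d := x in a ^+ 2 + b ^+ 2 + c ^+ 2 + d ^+ 2.

Lemma qmulA : associative qmul.
Proof. by case=> ????[????][????] /=; congr Quat; ring. Qed.

Lemma qmul1q : left_id qone qmul.
Proof. by case=> ???? /=; congr Quat; ring. Qed.

Lemma qmulq1 : right_id qone qmul.
Proof. by case=> ???? /=; congr Quat; ring. Qed.

Lemma qmulVq x : qmul (qconj x) x = Quat (qnorm2 x) 0 0 0.
Proof. by case: x => ???? /=; congr Quat; ring. Qed.

Lemma qmulqV x : qmul x (qconj x) = Quat (qnorm2 x) 0 0 0.
Proof. by case: x => ???? /=; congr Quat; ring. Qed.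

Lemma qnorm2M x y : qnorm2 (qmul x y) = qnorm2 x * qnorm2 y.
Proof. by case: x y => ????[????] /=; ring. Qed.

Lemma qnorm2V x : qnorm2 (qconj x) = qnorm2 x.
Proof. by case: x => ???? /=; ring. Qed.

Lemma qnorm2_1 : qnorm2 qone = 1.
Proof. by rewrite /=; ring. Qed.

End Quaternion.

Record unit_quaternion (R : realType) :=
  UnitQuaternion { uqval :> quaternion R; _ : qnorm2 uqval == 1 }.

HB.instance Definition _ (R : realType) := [isSub for @uqval R].
HB.instance Definition _ (R : realType) :=
  [Choice of unit_quaternion R by <:].

Section UnitQuaternion.
Variable R : realType.
Implicit Types x y z : unit_quaternion R.

Fact uqone_subproof : qnorm2 (qone R) == 1.
Proof. by rewrite qnorm2_1. Qed.
Definition uqone := UnitQuaternion uqone_subproof.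

Fact uqmul_subproof x y : qnorm2 (qmul x y) == 1.
Proof.
by case: x y => x /= /eqP x1 [y /= /eqP y1]; rewrite qnorm2M x1 y1 mulr1.
Qed.
Definition uqmul x y := UnitQuaternion (uqmul_subproof x y).

Fact uqinv_subproof x : qnorm2 (qconj x) == 1.
Proof. by case: x => x /= x1; rewrite qnorm2V. Qed.
Definition uqinv x := UnitQuaternion (uqinv_subproof x).

Fact uqmulA : associative uqmul.
Proof. by move=> x y z; apply/val_inj/qmulA. Qed.
Fact uqmul1q : left_id uqone uqmul.
Proof. by move=> x; apply/val_inj/qmul1q. Qed.
Fact uqmulq1 : right_id uqone uqmul.
Proof. by move=> x; apply/val_inj/qmulq1. Qed.
Fact uqmulVq : left_inverse uqone uqinv uqmul.
Proof.
by case=> x x1; apply: val_inj; rewrite /= qmulVq (eqP x1).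
Qed.
Fact uqmulqV : right_inverse uqone uqinv uqmul.
Proof.
by case=> x x1; apply: val_inj; rewrite /= qmulqV (eqP x1).
Qed.

HB.instance Definition _ := isGroup.Build (unit_quaternion R)
  uqmulA uqmul1q uqmulq1 uqmulVq uqmulqV.

Fact uqi_subproof : qnorm2 (Quat 0 1 0 0 : quaternion R) == 1.
Proof. by apply/eqP; rewrite /=; ring. Qed.
Definition uqi := UnitQuaternion uqi_subproof.

Fact uqomega_subproof :
  qnorm2 (Quat (- 2^-1) 2^-1 2^-1 2^-1 : quaternion R) == 1.
Proof. by apply/eqP; rewrite /=; field. Qed.
Definition uqomega := UnitQuaternion uqomega_subproof.

End UnitQuaternion.

Section GeneratedSubgroup.
Variables (G : groupType) (A : set G).

Definition generated : {pred G} := fun x =>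
  `[< forall H : {pred G}, group_closed H -> (forall a, A a -> a \in H) ->
      x \in H >].

Fact generated_closed : group_closed generated.
Proof.
split=> [|x y /asboolP Hx /asboolP Hy]; apply/asboolP => H clH AH.
  by case: clH.
by case: (clH) => _; apply; [apply: Hx | apply: Hy].
Qed.

Record generated_subgroup :=
  GeneratedSubgroup { gsval :> G; _ : gsval \in generated }.

HB.instance Definition _ := [isSub for gsval].
HB.instance Definition _ := [Choice of generated_subgroup by <:].
HB.instance Definition _ := SubChoice_isSubGroup.Build G generated
  generated_subgroup generated_closed.

End GeneratedSubgroup.

Definition binary_tetrahedral (R : realType) : groupType :=
  generated_subgroup [set uqi R; uqomega R]%classic.

(* Cohomology of the complex of inhomogeneous (bar) cochains of G, with values
   in an abelian group M on which G acts trivially. *)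
Section GroupCohomology.
Variables (G : groupType) (M : zmodType).

Definition cochain (q : nat) : Type := q.-tuple G -> M.
HB.instance Definition _ q := GRing.Zmodule.on (cochain q).

(* With entries numbered from 1, bar_face i (g_1, ..., g_(q+1)) is
     (g_2, ..., g_(q+1))                        if i = 0,
     (g_1, ..., g_i * g_(i+1), ..., g_(q+1))    if 1 <= i <= q,
     (g_1, ..., g_q)                            if i = q + 1. *)
Definition bar_face q (i : 'I_q.+2) (g : q.+1.-tuple G) : q.-tuple G :=
  [tuple let: (x, y) := (tnth g (widen_ord (leqnSn q) k),
                         tnth g (lift ord0 k)) in
         if (k.+1 < i)%N then x
         else if k.+1 == i then (x * y)%g else y | k < q].

Definition coboundary q (f : cochain q) : cochain q.+1 :=
  fun g => \sum_(i < q.+2) f (bar_face i g) *~ (-1) ^+ i.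

Fact coboundaryB q : {morph @coboundary q : f h / f - h}.
Proof.
move=> f h; apply/funext => g.
rewrite -[RHS]/(coboundary f g - coboundary h g) /coboundary -sumrB.
by apply: eq_bigr => i _; rewrite -mulrzBl.
Qed.
HB.instance Definition _ q :=
  GRing.isZmodMorphism.Build (cochain q) (cochain q.+1) (@coboundary q)
    (@coboundaryB q).

Lemma nth_bar_face q (i : 'I_q.+2) (g : q.+1.-tuple G) k : (k < q)%N ->
  nth 1%g (bar_face i g) k =
    if (k.+1 < i)%N then nth 1%g g k
    else if k.+1 == i then (nth 1%g g k * nth 1%g g k.+1)%g
    else nth 1%g g k.+1.
Proof.
move=> kq; rewrite -[k]/(nat_of_ord (Ordinal kq)) -tnth_nth tnth_mktuple.
by rewrite !(tnth_nth 1%g).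
Qed.

Lemma bar_face_bar_face q (i : 'I_q.+3) (j k : 'I_q.+2) (l : 'I_q.+3)
    (g : q.+2.-tuple G) : (j <= k)%N -> i = k.+1 :> nat -> l = j :> nat ->
  bar_face j (bar_face i g) = bar_face k (bar_face l g).
Proof.
move=> jk ik lj; apply: eq_from_tnth => n; rewrite !(tnth_nth 1%g).
have nq := ltn_ord n.
rewrite !nth_bar_face ?ltnS // ?(ltnW nq) // ik lj.
do ![case: ifPn => /= ?]; rewrite ?mulgA //; exfalso; lia.
Qed.

Lemma coboundaryK q (f : cochain q) : coboundary (coboundary f) = 0.
Proof.
apply/funext => g; rewrite -[RHS]/(0 : M) /coboundary.
pose h (i : 'I_q.+3) (j : 'I_q.+2) :=
  f (bar_face j (bar_face i g)) *~ (-1) ^+ j *~ (-1) ^+ i.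
transitivity (\sum_(i < q.+3) \sum_(j < q.+2) h i j).
  by apply: eq_bigr => i _; rewrite mulrz_suml.
transitivity (\sum_(i < q.+3) \sum_(j < q.+2 | (j < i)%N) h i j +
              \sum_(i < q.+3) \sum_(j < q.+2 | (i <= j)%N) h i j).
  rewrite -big_split /=; apply: eq_bigr => i _.
  rewrite (bigID (fun j : 'I__ => (j < i)%N)) /=; congr (_ + _).
  by apply: eq_bigl => j; rewrite -leqNgt.
rewrite big_ord_recl big_pred0 ?add0r; last by move=> j; rewrite ltn0.
rewrite [X in _ + X]big_ord_recr [X in _ + (_ + X)]big_pred0 ?addr0 /=;
  last by move=> j; apply/negbTE; rewrite -ltnNge.
rewrite [X in _ + X](exchange_big_dep xpredT) //= -big_split /=.
apply: big1 => k _; rewrite -big_split /=; apply: big1 => j jk.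
rewrite /h (@bar_face_bar_face q _ j k (widen_ord (leqnSn _) j)) //=.
rewrite -!mulrzA -mulrzDr /bump /= exprS.
by have -> : (-1) ^+ j * (-1 * (-1) ^+ k) + (-1) ^+ k * (-1) ^+ j = 0 :> int
  by ring.
Qed.

Record cocycle q :=
  Cocycle { cocval :> cochain q; _ : coboundary cocval == 0 }.

HB.instance Definition _ q := [isSub for @cocval q].
HB.instance Definition _ q := [Choice of cocycle q by <:].

Fact cocycle_closed q : zmod_closed (fun f : cochain q => coboundary f == 0).
Proof.
split=> [|f h]; rewrite !unfold_in; first by rewrite raddf0.
by move=> /eqP f0 /eqP h0; rewrite raddfB /= f0 h0 subr0.
Qed.
HB.instance Definition _ q :=
  GRing.SubChoice_isSubZmodule.Build _ _ (cocycle q) (@cocycle_closed q).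

Definition is_coboundary q : cochain q -> Prop :=
  match q with
  | 0 => fun f => f = 0
  | q'.+1 => fun f => exists h : cochain q', f = coboundary h
  end.

Definition coboundaries q : {pred cocycle q} :=
  fun f => `[< is_coboundary (cocval f) >].

Fact coboundaries_closed q : zmod_closed (@coboundaries q).
Proof.
case: q => [|q]; split.
- exact/asboolP.
- move=> f h /asboolP /= f0 /asboolP /= h0; apply/asboolP => /=.
  by rewrite f0 h0 subr0.
- by apply/asboolP; exists 0; rewrite raddf0.
- move=> f h /asboolP /= [f' eq_f] /asboolP /= [h' eq_h].
  by apply/asboolP; exists (f' - h'); rewrite raddfB /= eq_f eq_h.
Qed.
HB.instance Definition _ q :=
  GRing.isZmodClosed.Build (cocycle q) (@coboundaries q)
    (@coboundaries_closed q).

Definition cohomology q : zmodType := Quotient.quot (@coboundaries q).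

End GroupCohomology.

Definition zmod_isog (U V : zmodType) : Prop :=
  exists f : {additive U -> V}, bijective f.

(* Main.v *)
Require Import Defs.
From HB Require Import structures.
From mathcomp Require Import all_boot all_order all_algebra ring zify.
From mathcomp Require Import boolp classical_sets functions reals.

Set Implicit Arguments.
Unset Strict Implicit.
Unset Printing Implicit Defensive.

Import Order.TTheory GRing.Theory Num.Theory.
Local Open Scope ring_scope.

(** Let T be the binary tetrahedral group. It is presented by two generators
    s and t with the relations t s t = s s and s t s = t t, and it acts freely
    on the 3-sphere, which has an equivariant cell structure with 1, 2, 2 and 1
    orbits of cells in dimensions 0, 1, 2 and 3: the 2-skeleton is the Cayley
    complex of this presentation. Its cellular cochains form an exact sequence

      0 -> Z -> A -> A^2 -> A^2 -> A -> Z -> 0,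

    where A is the module of all functions T -> Z, on which T acts by right
    translation. Splicing copies of this sequence gives a resolution of Z of
    period 4, with differentials d0, d1, d2 and d3.

    The modules A are coinduced, so T has no cohomology in positive degrees
    with coefficients in A, and the cohomology of T with coefficients in Z is
    that of the T-invariants of the resolution (cohomology_isog). The invariants
    of A are the constant functions, and on them the differentials become

      Z --0--> Z^2 --m--> Z^2 --0--> Z --24--> Z --0--> Z^2 --m--> ...

    where m (a, b) = (2 b - a, 2 a - b) has determinant -3. The cohomology of
    this complex is Z in degree 0, and then 0, Z/3, 0, Z/24, periodically: see
    const_map_d1 and const_map_d3 for the two nonzero maps and
    const_cohomology1, ..., const_cohomology4 for the groups.

    Exactness of the sequence is the only fact that depends on the geometry.
    It is proved by a contracting homotopy, obtained by collapsing the sphere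
    minus one cell (fill1, fill2, fill3) and verified by computation
    (homotopy_check0, ..., homotopy_check3). *)

(** * Cochains with coinduced coefficients *)

Lemma bar_face_cons (G : groupType) q (i : 'I_q.+2) (z : G)
    (g : q.+1.-tuple G) :
  bar_face (lift ord0 i) [tuple of z :: g] =
  [tuple of (z * (if i == 0%N :> nat then thead g else 1))%g :: bar_face i g].
Proof.
apply: eq_from_tnth => k; rewrite !(tnth_nth 1%g).
have kq := ltn_ord k.
rewrite nth_bar_face //=.
case: k kq => [[|k] kq'] /= kq.
  rewrite /bump; case: (i : nat) => [|[|n]] //=; rewrite ?mulg1 //.
  by rewrite /thead (tnth_nth 1%g).
rewrite nth_bar_face //; rewrite /bump /= ltnS eqSS; case: ifP=> // _.
Qed.

Lemma bar_face0 (G : groupType) q (z : G) (g : q.-tuple G) :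
  bar_face ord0 [tuple of z :: g] = g.
Proof.
apply: eq_from_tnth => k; rewrite !(tnth_nth 1%g).
by rewrite nth_bar_face.
Qed.

Lemma cons_thead (G : groupType) q (y : q.+1.-tuple G) :
  y = [tuple of thead y :: bar_face ord0 y].
Proof. by case/tupleP: y => z g; rewrite bar_face0 theadE. Qed.

Lemma coboundary_cons (G : groupType) (V : zmodType) q (f : cochain G V q.+1)
    (x : G) (g : q.+1.-tuple G) :
  coboundary f [tuple of x :: g] = f g -
    \sum_(i < q.+2) f [tuple of (x * (if i == 0%N :> nat then thead g else 1))%g
                       :: bar_face i g] *~ (-1) ^+ i.
Proof.
rewrite /coboundary big_ord_recl expr0 mulr1z bar_face0 -sumrN; congr (_ + _).
apply: eq_bigr => i _; rewrite bar_face_cons /bump /= exprS mulN1r.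
exact: mulrNz.
Qed.

(** The action of G that makes the functions G -> V a coinduced module. *)
Definition translate (G : groupType) (V : zmodType) (c : G) (a : G -> V) :
  G -> V := fun x => a (x * c)%g.

Section CoinducedCochains.
Variables (G : groupType) (V : zmodType).
Implicit Type q : nat.

(** The bar coboundary for the translation action; in the face that drops the
    first entry of g, that entry acts on the coefficients. *)
Definition coind_coboundary q (F : cochain G (G -> V) q) :
    cochain G (G -> V) q.+1 := fun g =>
  \sum_(i < q.+2)
    translate (if i == 0%N :> nat then thead g else 1%g) (F (bar_face i g))
      *~ (-1) ^+ i.

(** The contraction that makes coinduced modules acyclic: the argument of the
    coefficient function becomes the first entry of the cochain. *)
Definition coind_contraction q (F : cochain G (G -> V) q.+1) :
    cochain G (G -> V) q := fun g x => F [tuple of x :: g] 1%g.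

(** Makes the theory of the coboundary with trivial coefficients available for
    coinduced ones, at the price of a shift in degree. *)
Definition uncurry_cochain q (F : cochain G (G -> V) q) : cochain G V q.+1 :=
  fun y => F (bar_face ord0 y) (thead y).

Lemma fct_mulrz (a : G -> V) (n : int) x : (a *~ n) x = a x *~ n.
Proof.
have fct_mulrn m : (a *+ m) x = a x *+ m.
  by elim: m => [|m IH]; rewrite ?mulr0n // !mulrS -IH.
by case: n => n; rewrite ?NegzE ?mulrNz -?pmulrn -?fct_mulrn.
Qed.

Lemma coind_coboundaryE q (F : cochain G (G -> V) q) g x :
  coind_coboundary F g x = \sum_(i < q.+2)
    F (bar_face i g) (x * (if i == 0%N :> nat then thead g else 1))%g
      *~ (-1) ^+ i.
Proof.
by rewrite /coind_coboundary fct_sumE; apply: eq_bigr => i _; rewrite fct_mulrz.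
Qed.

(** Reduces the twisted coboundary to the trivial one, so that its square
    vanishes because that of the trivial coboundary does. *)
Lemma coind_coboundary_uncurry q (F : cochain G (G -> V) q) g x :
  coind_coboundary F g x =
  uncurry_cochain F g - coboundary (uncurry_cochain F) [tuple of x :: g].
Proof.
rewrite coboundary_cons subKr coind_coboundaryE; apply: eq_bigr => i _.
by rewrite /uncurry_cochain bar_face0 theadE.
Qed.

Fact coind_coboundaryB q : {morph @coind_coboundary q : F H / F - H}.
Proof.
move=> F H; apply/funext => g; apply/funext => x.
rewrite -[RHS]/(coind_coboundary F g x - coind_coboundary H g x).
rewrite !coind_coboundaryE -sumrB; apply: eq_bigr => i _.
by rewrite -mulrzBl.
Qed.
HB.instance Definition _ q :=
  GRing.isZmodMorphism.Build (cochain G (G -> V) q) (cochain G (G -> V) q.+1)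
    (@coind_coboundary q) (@coind_coboundaryB q).

Lemma coind_coboundaryK q (F : cochain G (G -> V) q) :
  coind_coboundary (coind_coboundary F) = 0.
Proof.
apply/funext => g; apply/funext => x; rewrite coind_coboundary_uncurry.
set F1 := uncurry_cochain F.
have -> : uncurry_cochain (coind_coboundary F) =
    (fun y => F1 (bar_face ord0 y)) - coboundary F1.
  apply/funext => y; rewrite {1}/uncurry_cochain coind_coboundary_uncurry.
  by rewrite -cons_thead.
rewrite raddfB /= coboundaryK subr0 coboundary_cons.
rewrite [X in X - _]/(F1 (bar_face ord0 g) - coboundary F1 g).
rewrite [X in _ - (_ - X)](_ : _ = coboundary F1 g) ?subrr //.
by apply: eq_bigr => i _; rewrite bar_face0.
Qed.

Lemma coind_homotopy q (F : cochain G (G -> V) q.+1) :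
  coind_coboundary (coind_contraction F) +
  coind_contraction (coind_coboundary F) = F.
Proof.
apply/funext => g; apply/funext => x.
rewrite -[LHS]/(coind_coboundary (coind_contraction F) g x +
  coind_coboundary F [tuple of x :: g] 1%g) !coind_coboundaryE.
rewrite [X in _ + X]big_ord_recl /= bar_face0 expr0 mulr1z theadE mul1g.
rewrite addrCA -big_split /= big1 ?addr0 // => i _.
rewrite bar_face_cons mulg1 /bump /= exprS mulN1r.
by rewrite [X in _ + X]mulrNz subrr.
Qed.

Lemma coind_coboundary0 (F : cochain G (G -> V) 0) (y : 1.-tuple G) x :
  coind_coboundary F y x = F [tuple] (x * thead y)%g - F [tuple] x.
Proof.
rewrite coind_coboundaryE !big_ord_recl big_ord0 /= addr0 mulr1z mulg1.
by rewrite !(tuple0 (bar_face _ _)) /bump /= expr1 mulrNz mulr1z.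
Qed.

Lemma coind_cocycle0 (F : cochain G (G -> V) 0) :
  coind_coboundary F = 0 <-> F = fun _ _ => F [tuple] 1%g.
Proof.
split=> [dF|->]; apply/funext => y; apply/funext => x.
  have /(congr1 (fun H => H [tuple x] 1%g)) := dF.
  rewrite coind_coboundary0 theadE mul1g => /eqP.
  by rewrite subr_eq0 (tuple0 y) => /eqP ->.
by rewrite coind_coboundary0 subrr.
Qed.

Lemma coind_coboundary_const q (f : cochain G V q) :
  coind_coboundary (fun g _ => f g) = (fun g _ => coboundary f g).
Proof. by apply/funext => g; apply/funext => x; rewrite coind_coboundaryE. Qed.

End CoinducedCochains.

(** * Cohomology from a coinduced resolution *)

Section Reduction.
Variable G : groupType.

Section Maps.
Variables V W : zmodType.

Definition coind_map (d : (G -> V) -> (G -> W)) q (F : cochain G (G -> V) q) :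
  cochain G (G -> W) q := fun g => d (F g).

Definition equivariant (d : (G -> V) -> (G -> W)) :=
  forall c a, d (translate c a) = translate c (d a).

(** The map that d induces on invariants, which are the constant functions. *)
Definition const_map (d : (G -> V) -> (G -> W)) (v : V) : W :=
  d (fun _ => v) 1%g.

Variable d : {additive (G -> V) -> (G -> W)}.

Fact coind_mapB q : {morph @coind_map d q : F H / F - H}.
Proof. by move=> F H; apply/funext => g; exact: raddfB. Qed.
HB.instance Definition _ q :=
  GRing.isZmodMorphism.Build (cochain G (G -> V) q) (cochain G (G -> W) q)
    (@coind_map d q) (@coind_mapB q).

Fact const_mapB : {morph const_map d : u v / u - v}.
Proof.
move=> u v; rewrite /const_map.
rewrite -[RHS]/((d (fun _ => u) - d (fun _ => v)) 1%g).
by rewrite -raddfB.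
Qed.
HB.instance Definition _ :=
  GRing.isZmodMorphism.Build V W (const_map d) const_mapB.

Hypothesis dG : equivariant d.

Lemma coind_map_coboundary q (F : cochain G (G -> V) q) :
  coind_map d (coind_coboundary F) = coind_coboundary (coind_map d F).
Proof.
apply/funext => g; rewrite /coind_map raddf_sum.
by apply: eq_bigr => i _; rewrite raddfMz dG.
Qed.

Lemma const_mapE (v : V) : d (fun _ => v) = fun _ => const_map d v.
Proof.
apply/funext => x; rewrite /const_map.
by rewrite -[LHS](congr1 (d (fun _ => v)) (mul1g x))
  -[LHS]/(translate x _ 1%g) -dG.
Qed.

End Maps.

(** A sequence of coinduced modules that is exact in positive degrees: a
    coinduced resolution of the kernel of its first differential. *)
Record coind_complex := CoindComplex {
  obj : nat -> zmodType;
  diff : forall n, {additive (G -> obj n) -> (G -> obj n.+1)};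
  diffG : forall n, equivariant (diff n);
  diffK : forall n a, diff n.+1 (diff n a) = 0;
  diff_exact : forall n a, diff n.+1 a = 0 -> exists b, a = diff n b }.

Definition shift (C : coind_complex) : coind_complex :=
  @CoindComplex (fun n => obj C n.+1) (fun n => diff C n.+1)
    (fun n => @diffG C n.+1) (fun n => @diffK C n.+1)
    (fun n => @diff_exact C n.+1).

(** Dimension shifting, carried out on cochains. Let K_n be the kernel of
    diff C n. A cocycle of degree q > 0 with values in K_0 is the coboundary
    of its contraction H, and the image of H under diff C 0 is a cocycle of
    degree q - 1 with values in K_1. After q steps there remains an invariant
    element of K_q, that is, a constant function. *)
Fixpoint reduce q (C : coind_complex) : cochain G (G -> obj C 0) q -> obj C q :=
  match q with
  | 0 => fun F => F [tuple] 1%g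
  | q'.+1 => fun F =>
      @reduce q' (shift C) (coind_map (diff C 0) (coind_contraction F))
  end.

(** Degree 0 boundaries are trivial since the complex of invariants starts
    there. *)
Definition const_boundary (C : coind_complex) q : obj C q -> Prop :=
  match q with
  | 0 => fun v => v = 0
  | q'.+1 => fun v => exists u, v = const_map (diff C q') u
  end.

(** Cocycles and coboundaries for the coefficient module ker (diff C 0). *)
Definition kernel_cocycle (C : coind_complex) q
    (F : cochain G (G -> obj C 0) q) :=
  coind_coboundary F = 0 /\ coind_map (diff C 0) F = 0.

Definition kernel_coboundary (C : coind_complex) q :
    cochain G (G -> obj C 0) q -> Prop :=
  match q with
  | 0 => fun F => F = 0
  | q'.+1 => fun F =>
      exists2 H, F = coind_coboundary H & coind_map (diff C 0) H = 0
  end.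

Implicit Types (C : coind_complex) (q : nat).

Fact reduceB q C : {morph @reduce q C : F H / F - H}.
Proof.
elim: q C => [//|q IH] C F H /=.
apply: etrans (IH (shift C) _ _); congr (reduce _).
exact: (raddfB (@coind_map _ _ (diff C 0) q)).
Qed.
HB.instance Definition _ q C :=
  GRing.isZmodMorphism.Build (cochain G (G -> obj C 0) q) (obj C q)
    (@reduce q C) (@reduceB q C).

Lemma contraction_kernel_cocycle C q (F : cochain G (G -> obj C 0) q.+1) :
  kernel_cocycle F ->
  @kernel_cocycle (shift C) q (coind_map (diff C 0) (coind_contraction F)).
Proof.
case=> F0 dF; split; last by apply/funext => g; exact: diffK.
rewrite -coind_map_coboundary; last exact: diffG.
have := coind_homotopy F; rewrite F0 => FE.
by rewrite -dF -[in RHS]FE [coind_contraction 0](_ : _ = 0) ?addr0.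
Qed.

Lemma reduce_cocycle q C (F : cochain G (G -> obj C 0) q) :
  kernel_cocycle F -> const_map (diff C q) (reduce F) = 0.
Proof.
elim: q C F => [|q IH] C F FP /=.
  case: FP => /coind_cocycle0 F0 /(congr1 (fun H => H [tuple] 1%g)).
  by rewrite /coind_map F0.
exact: IH (contraction_kernel_cocycle FP).
Qed.

Lemma const_boundaryB q C (v w : obj C q) :
  const_boundary v -> const_boundary w -> const_boundary (v - w).
Proof.
case: q v w => [|q] v w /=; first by move=> -> ->; rewrite subrr.
by case=> u -> [u' ->]; exists (u - u'); rewrite raddfB.
Qed.

Lemma const_boundary0 q C : const_boundary (0 : obj C q).
Proof. by case: q => [|q] //=; exists 0; rewrite raddf0. Qed.

Lemma const_boundaryN q C (v : obj C q) :
  const_boundary v -> const_boundary (- v).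
Proof. by rewrite -sub0r; apply/const_boundaryB/const_boundary0. Qed.

Lemma const_boundaryS q C (v : obj C q.+1) :
  @const_boundary (shift C) q v -> @const_boundary C q.+1 v.
Proof.
case: q v => [|q] v //= ->; exact: (@const_boundary0 1).
Qed.

(** Exactness holds pointwise, and bar cochains are arbitrary functions. *)
Lemma exact_cochain C q (F : cochain G (G -> obj C 1) q) :
  coind_map (diff C 1) F = 0 -> exists H, F = coind_map (diff C 0) H.
Proof.
move=> F0.
have /choice[H HP] : forall g, exists b, F g = diff C 0 b.
  by move=> g; apply: diff_exact; have /(congr1 (fun H => H g)) := F0.
by exists H; apply/funext => g; rewrite HP.
Qed.

(** The reduction of a coboundary, for H with values in obj C 0 rather than in
    the kernel of diff C 0: the contraction of the coboundary of H is H minus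
    the coboundary of its own contraction, so one step of the reduction yields
    the image of H under diff C 0 up to a coboundary, and induction applies to
    the latter. This gives both the invariance of reduce under coboundaries and
    the correction needed for its surjectivity. *)
Lemma reduce_coboundaryB q C (H : cochain G (G -> obj C 0) q) :
  @const_boundary C q.+1
    (@reduce q (shift C) (coind_map (diff C 0) H) -
     @reduce q.+1 C (coind_coboundary H)).
Proof.
elim: q C H => [|q IH] C H.
  exists (H [tuple] 1%g); rewrite /= /coind_map.
  have -> : coind_contraction (coind_coboundary H) [tuple] =
      H [tuple] - (fun _ => H [tuple] 1%g).
    apply/funext => x; rewrite -[LHS]/(coind_coboundary H [tuple x] 1%g).
    by rewrite coind_coboundary0 theadE mul1g.
  by rewrite raddfB; exact: subKr.
set K := coind_map (diff C 0) (coind_contraction H).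
have /const_boundaryN := IH (shift C) K.
have -> : coind_map (diff (shift C) 0) K = 0.
  by apply/funext => g; exact: diffK.
have -> : coind_coboundary K = coind_map (diff C 0) H -
    coind_map (diff C 0) (coind_contraction (coind_coboundary H)).
  rewrite -coind_map_coboundary; last exact: diffG.
  by rewrite -{2}[H]coind_homotopy -raddfB addrK.
by rewrite raddf0 sub0r opprK raddfB.
Qed.

Lemma reduce_coboundary q C (F : cochain G (G -> obj C 0) q) :
  kernel_coboundary F -> const_boundary (reduce F).
Proof.
case: q F => [|q] F /=; first by move=> ->.
case=> H -> dH; have := const_boundaryN (reduce_coboundaryB H).
by rewrite dH raddf0 sub0r opprK.
Qed.

Lemma coind_coboundary_contraction C q (F : cochain G (G -> obj C 0) q.+1) :
  coind_coboundary F = 0 -> coind_coboundary (coind_contraction F) = F.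
Proof.
move=> F0; have := coind_homotopy F; rewrite F0.
by rewrite [coind_contraction 0](_ : _ = 0) ?addr0.
Qed.

(** If one step of the reduction turns F into a coboundary, its primitive H
    lifts along diff C 0 to some H' by exactness, and subtracting the coboundary
    of H' from the contraction of F puts this primitive of F into the kernel. In
    degree 1 a constant function plays the role of the coboundary of H'. *)
Lemma kernel_coboundary_reduce q C (F : cochain G (G -> obj C 0) q) :
  kernel_cocycle F -> const_boundary (reduce F) -> kernel_coboundary F.
Proof.
case: q F => [|q] F.
  by case=> /coind_cocycle0 -> _ /= ->.
elim: q C F => [|q IH] C F FP /=.
  have [/coind_cocycle0 cF _] := contraction_kernel_cocycle FP.
  rewrite cF => -[v vP]; exists (coind_contraction F - (fun _ _ => v)).
    rewrite raddfB /= coind_coboundary_contraction; last by case: FP.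
    rewrite [X in _ - X](_ : _ = 0) ?subr0 //.
    exact/coind_cocycle0.
  rewrite raddfB /= cF vP; apply/funext => g.
  rewrite -[LHS]/(_ - diff C 0 (fun _ => v)) const_mapE; last exact: diffG.
  exact: subrr.
move/(IH _ _ (contraction_kernel_cocycle FP)) => [H FH dH].
have [H' HH'] := exact_cochain dH.
exists (coind_contraction F - coind_coboundary H').
  rewrite raddfB /= coind_coboundaryK subr0 coind_coboundary_contraction //.
  by case: FP.
rewrite raddfB /= FH HH' coind_map_coboundary ?subrr //; exact: diffG.
Qed.

(** The steps of the reduction are reversed by lifting along diff C 0, and then
    taking the coboundary. *)
Lemma reduce_surj q C (v : obj C q) : const_map (diff C q) v = 0 ->
  exists2 F : cochain G (G -> obj C 0) q,
    kernel_cocycle F & const_boundary (reduce F - v).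
Proof.
elim: q C v => [|q IH] C v v0 /=.
  exists (fun _ _ => v); last by rewrite subrr.
  split; first exact/coind_cocycle0.
  apply/funext => g; rewrite /coind_map const_mapE ?v0 //; exact: diffG.
have [F1 [F0 dF] /const_boundaryS bF1] := IH (shift C) v v0.
have [H F1H] := exact_cochain dF.
have kH : kernel_cocycle (coind_coboundary H).
  split; rewrite ?coind_coboundaryK // coind_map_coboundary -?F1H //.
  exact: diffG.
exists (coind_coboundary H) => //.
have := const_boundaryB bF1 (reduce_coboundaryB H).
rewrite F1H; set a := (a in a - v); set b := (b in _ - (_ - b)).
have -> : a - v - (a - b) = b - v by rewrite addrAC opprB addrCA subrr addr0.
by [].
Qed.

End Reduction.

Lemma zmod_isog_quot (U W : zmodType) (S : zmodClosed U)
    (chi : {additive U -> W}) :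
  (forall u, chi u = 0 <-> u \in S) -> (forall w, exists u, chi u = w) ->
  zmod_isog (Quotient.quot S) W.
Proof.
move=> chi0 /choice[sec secK].
pose f (x : Quotient.quot S) := chi (repr x).
have fpi u : f (\pi u)%qT = chi u.
  apply/eqP; rewrite -subr_eq0 -raddfB; apply/eqP/chi0.
  by rewrite Quotient.idealrBE reprK.
have fB : zmod_morphism f.
  by move=> x y; rewrite -[x]reprK -[y]reprK -raddfB !fpi raddfB.
pose fA := GRing.isZmodMorphism.Build _ _ f fB.
pose F : {additive Quotient.quot S -> W} := HB.pack f fA.
exists F; exists (fun w => \pi_(Quotient.quot S)%qT (sec w)) => [x|w] /=;
  last by rewrite fpi.
rewrite -[RHS]reprK; apply/eqP; rewrite -Quotient.idealrBE.
by apply/chi0; rewrite raddfB secK subrr.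
Qed.

Section Comparison.
Variables (G : groupType) (C : coind_complex G).
Hypothesis C_const : forall a, diff C 0 a = 0 <-> exists m, a = fun _ => m.

Definition const_cochain q (f : cochain G (obj C 0) q) :
  cochain G (G -> obj C 0) q := fun g _ => f g.

Lemma coind_map_const q (f : cochain G (obj C 0) q) :
  coind_map (diff C 0) (const_cochain f) = 0.
Proof. by apply/funext => g; apply/C_const; exists (f g). Qed.

Lemma coind_map_kernel q (F : cochain G (G -> obj C 0) q) :
  coind_map (diff C 0) F = 0 -> exists f, F = const_cochain f.
Proof.
move=> dF.
have /choice[f fP] : forall g, exists m, F g = fun _ => m.
  by move=> g; apply/C_const; have /(congr1 (fun H => H g)) := dF.
by exists f; apply/funext => g; rewrite fP.
Qed.

Lemma kernel_cocycle_const q (f : cochain G (obj C 0) q) :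
  kernel_cocycle (const_cochain f) <-> coboundary f = 0.
Proof.
rewrite /kernel_cocycle coind_coboundary_const; split=> [[f0 _]|f0].
  by apply/funext => g; have /(congr1 (fun H => H g 1%g)) := f0.
by split; [rewrite f0 | exact: coind_map_const].
Qed.

Lemma kernel_coboundary_const q (f : cochain G (obj C 0) q) :
  kernel_coboundary (const_cochain f) <-> is_coboundary f.
Proof.
case: q f => [|q] f /=; split.
- move=> f0; apply/funext => g.
  by have /(congr1 (fun H => H g 1%g)) := f0.
- by move->.
- case=> H fE /coind_map_kernel[h hE]; exists h; apply/funext => g.
  have /(congr1 (fun H => H g 1%g)) := fE.
  by rewrite hE coind_coboundary_const.
- case=> h ->; exists (const_cochain h); last exact: coind_map_const.
  by rewrite coind_coboundary_const.
Qed.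

(** With constant functions as the kernel of diff C 0, group cohomology is the
    cohomology of the complex of invariants, here identified with W by means of
    a map theta defined on all of obj C q. *)
Lemma cohomology_isog q (W : zmodType) (theta : {additive obj C q -> W}) :
  (forall v, const_map (diff C q) v = 0 ->
     theta v = 0 <-> const_boundary v) ->
  (forall w, exists2 v, const_map (diff C q) v = 0 & theta v = w) ->
  zmod_isog (cohomology G (obj C 0) q) W.
Proof.
move=> theta0 theta_surj.
pose chi (f : cocycle G (obj C 0) q) :=
  theta (reduce (const_cochain (cocval f))).
have chiB : zmod_morphism chi.
  by move=> f h; rewrite /chi -2!raddfB; congr (theta (reduce _)).
pose chiA := GRing.isZmodMorphism.Build _ _ chi chiB.
apply: (@zmod_isog_quot _ _ _ (HB.pack chi chiA : {additive _ -> _})).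
  case=> f f0; rewrite /= /chi /= theta0; last first.
    exact/reduce_cocycle/kernel_cocycle_const/eqP.
  have kf : kernel_cocycle (const_cochain f).
    exact/kernel_cocycle_const/eqP.
  split=> [/(kernel_coboundary_reduce kf) bf|/asboolP bf].
    exact/asboolP/kernel_coboundary_const.
  exact/reduce_coboundary/kernel_coboundary_const.
move=> w; have [v v0 <-] := theta_surj w.
have [F kF bF] := reduce_surj v0.
have [f FE] := coind_map_kernel kF.2; rewrite FE in kF bF.
have /kernel_cocycle_const/eqP f0 := kF.
exists (Cocycle f0); rewrite /= /chi /=.
apply/eqP; rewrite -subr_eq0 -raddfB; apply/eqP/theta0 => //.
by rewrite raddfB /= v0 (reduce_cocycle kF) subrr.
Qed.

End Comparison.

(** * The multiplication table of the binary tetrahedral group *)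

(** Doubled coordinates: (a, b, c, d) stands for (a + b i + c j + d k) / 2. *)
Definition hurwitz := (int * int * int * int)%type.

Definition hprod (x y : hurwitz) : hurwitz :=
  let: (a, b, c, d) := x in let: (a', b', c', d') := y in
  (a * a' - b * b' - c * c' - d * d', a * b' + b * a' + c * d' - d * c',
   a * c' - b * d' + c * a' + d * b', a * d' + b * c' - c * b' + d * a').

Definition hdouble (x : hurwitz) : hurwitz :=
  let: (a, b, c, d) := x in (2 * a, 2 * b, 2 * c, 2 * d).

(** The product in doubled coordinates, hence the halving; the divisions are
    exact for the quaternions at hand, which the proofs about the table check
    by comparing hprod with hdouble. *)
Definition hmul (x y : hurwitz) : hurwitz :=
  let: (a, b, c, d) := hprod x y in
  ((a %/ 2)%Z, (b %/ 2)%Z, (c %/ 2)%Z, (d %/ 2)%Z).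

(** The letters of words: false is s = (1 + i + j + k) / 2 and true is
    t = (1 + i + j - k) / 2. They satisfy t s t = s s and s t s = t t. *)
Definition hgen (b : bool) : hurwitz :=
  if b then (1, 1, 1, -1) else (1, 1, 1, 1).

(** Normal forms of the 24 elements: s generates a cyclic subgroup of order 6,
    whose right cosets are represented by 1, t, t s and t s s. *)
Definition word k : seq bool :=
  nseq (k %% 6) false ++
  (if (k %/ 6)%N is b.+1 then true :: nseq b false else [::]).

Definition hword (w : seq bool) : hurwitz :=
  foldr (fun b => hmul (hgen b)) (2, 0, 0, 0) w.

Definition hurwitz_elt k := hword (word k).

Definition hurwitz_elts := map hurwitz_elt (iota 0 24).

Definition lmul_s_table := Eval vm_compute in
  [seq index (hmul (hgen false) x) hurwitz_elts | x <- hurwitz_elts].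
Definition lmul_t_table := Eval vm_compute in
  [seq index (hmul (hgen true) x) hurwitz_elts | x <- hurwitz_elts].
Definition lmul_s k := nth 0%N lmul_s_table k.
Definition lmul_t k := nth 0%N lmul_t_table k.

(** * Integral linear forms and collapsing *)

Definition form := seq (int * nat).

Definition eval (L : form) (v : nat -> int) : int :=
  \sum_(c <- L) c.1 * v c.2.

Definition subst (S : nat -> form) (L : form) : form :=
  flatten [seq [seq (c.1 * b.1, b.2) | b <- S c.2] | c <- L].

Definition coef (L : form) i : int :=
  foldr (fun c a => if c.2 == i then c.1 + a else a) 0 L.

Definition is_unit_form N (L : form) k :=
  all (fun c => (c.2 < N)%N) L &&
  all (fun i => coef L i == if i == k then 1 else 0) (iota 0 N).

Lemma eval_cat L1 L2 v : eval (L1 ++ L2) v = eval L1 v + eval L2 v.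
Proof. exact: big_cat. Qed.

Lemma eval_subst S L v : eval (subst S L) v = eval L (fun i => eval (S i) v).
Proof.
rewrite /eval /subst big_flatten /= big_map; apply: eq_bigr => c _.
by rewrite big_map mulr_sumr; apply: eq_bigr => b _; rewrite mulrA.
Qed.

Lemma eval_coef N L v : all (fun c => (c.2 < N)%N) L ->
  eval L v = \sum_(0 <= i < N) coef L i * v i.
Proof.
rewrite /eval; elim: L => [|c L IH] /=.
  by move=> _; rewrite big_nil big1 // => i _; rewrite mul0r.
case/andP=> cN /IH {}IH; rewrite big_cons IH.
rewrite [RHS](eq_bigr (fun i => (if c.2 == i then c.1 * v i else 0) +
    coef L i * v i)); last first.
  by move=> i _; case: eqP => _; rewrite ?mulrDl ?add0r.
rewrite big_split /=; congr (_ + _).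
rewrite (bigD1_seq c.2) ?mem_index_iota ?iota_uniq //= eqxx big1 ?addr0 // => i.
by rewrite eq_sym => /negbTE ->.
Qed.

Lemma eval_unit_form N L k v :
  (k < N)%N -> is_unit_form N L k -> eval L v = v k.
Proof.
move=> kN /andP[LN /allP Lk]; rewrite (eval_coef _ LN).
rewrite (bigD1_seq k) ?mem_index_iota ?iota_uniq //=.
rewrite (eqP (Lk k _)) ?mem_iota // eqxx mul1r big1_seq ?addr0 // => i.
rewrite mem_index_iota => /andP[/negbTE ik iN].
by rewrite (eqP (Lk i _)) ?mem_iota // ik mul0r.
Qed.

(** Certifies D S + S' D' = 1 on N coordinates: the matrices D and D' of two
    consecutive differentials and the components S and S' of a contracting
    homotopy are given by their rows. *)
Definition homotopy_check N (S D D' S' : nat -> form) :=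
  all (fun k => is_unit_form N (subst S (D k) ++ subst D' (S' k)) k) (iota 0 N).

Lemma homotopy_eval N S D D' S' (v : nat -> int) :
  homotopy_check N S D D' S' -> (forall i, eval (D' i) v = 0) ->
  forall k, (k < N)%N -> eval (D k) (fun i => eval (S i) v) = v k.
Proof.
move=> /allP ok v0 k kN; have /ok/(eval_unit_form v kN) <- : k \in iota 0 N.
  by rewrite mem_iota.
rewrite eval_cat !eval_subst [X in _ + X]big1 ?addr0 // => c _.
by rewrite v0 mulr0.
Qed.

Definition rows_of (M : seq (nat * form)) i : form :=
  nth [::] (unzip2 M) (index i (unzip1 M)).

(** Solves the equations (d x) f = y f, for x vanishing on the known cells, by
    collapsing: as long as some face f has exactly one undetermined cell i,
    with coefficient a, the equation at f gives
    x i = a * (y f - the contribution of the other cells of f).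
    The result lists the solved cells with the linear form in y that gives
    their value; a face used for the cell i heads the form of i. Since a = 1
    or -1 in all uses, a is its own inverse. *)
Fixpoint collapse (d : nat -> form) (faces known : seq nat) fuel M :=
  let free f := [seq c <- d f | c.2 \notin known ++ unzip1 M] in
  match fuel, [seq (f, free f) | f <- faces & size (free f) == 1%N] with
  | fuel'.+1, (f, [:: (a, i)]) :: _ =>
    let rest := [seq (- a * b.1, b.2) | b <- d f & b.2 != i] in
    collapse d faces known fuel' ((i, (a, f) :: subst (rows_of M) rest) :: M)
  | _, _ => M
  end.

Definition filled_faces (M : seq (nat * form)) :=
  [seq (head (0, 0%N) c.2).2 | c <- M].

(** * Filling the cells of the universal cover *)

(** Matrices of the differentials d0, d1, d2, d3 of the periodic resolution,
    where coordinate k < 24 is the value at the k-th element of the group and,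
    for pairs of functions, coordinate 24 + k is the value of the second
    function there. *)
Definition row0 c : form := let k := (c %% 24)%N in
  if (c < 24)%N then [:: (1, lmul_s k); (-1, k)]
  else [:: (1, lmul_t k); (-1, k)].

Definition row1 c : form := let k := (c %% 24)%N in
  if (c < 24)%N then
    [:: (1, (24 + k)%N); (1, lmul_t k); (1, (24 + lmul_s (lmul_t k))%N);
        (-1, k); (-1, lmul_s k)]
  else
    [:: (1, k); (1, (24 + lmul_s k)%N); (1, lmul_t (lmul_s k));
        (-1, (24 + k)%N); (-1, (24 + lmul_t k)%N)].

Definition row2 c : form := let k := (c %% 24)%N in
  [:: (1, k); (-1, lmul_s k); (1, (24 + k)%N); (-1, (24 + lmul_t k)%N)].

Definition row3 (c : nat) : form := [seq (1, k) | k <- iota 0 24].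

(** A cell used up in one dimension serves as a known cell in the next: the
    23 edges reaching the vertices other than 0 form a spanning tree, 25 of the
    48 two-cells fill the remaining edges, and 23 of the 24 three-cells fill the
    remaining two-cells. The last three-cell is the one that the sphere has in
    excess of a ball. *)
Definition fill1 := Eval vm_compute in
  collapse row0 (iota 0 48) [:: 0]%N 48 [::].
Definition fill2 := Eval vm_compute in
  collapse row1 (iota 0 48) (filled_faces fill1) 48 [::].
Definition fill3 := Eval vm_compute in
  collapse row2 (iota 0 24) (filled_faces fill2) 48 [::].

Definition homotopy1 := rows_of fill1.
Definition homotopy2 := rows_of fill2.
Definition homotopy3 := rows_of fill3.
Definition homotopy4 k : form :=
  if k \in filled_faces fill3 then [::] else [:: (1, 0%N)].

(* The first homotopy is evaluation at vertex 0, and the first differential is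
   the embedding of the constant functions. *)
Lemma homotopy_check0 :
  homotopy_check 24 (fun _ => [:: (1, 0%N)]) (fun _ => [:: (1, 0%N)])
    row0 homotopy1.
Proof. by vm_compute. Qed.

Lemma homotopy_check1 : homotopy_check 48 homotopy1 row0 row1 homotopy2.
Proof. by vm_compute. Qed.

Lemma homotopy_check2 : homotopy_check 48 homotopy2 row1 row2 homotopy3.
Proof. by vm_compute. Qed.

Lemma homotopy_check3 : homotopy_check 24 homotopy3 row2 row3 homotopy4.
Proof. by vm_compute. Qed.

(** * A four-periodic resolution *)

Lemma nat_ind4 (P : nat -> Prop) : P 0 -> P 1 -> P 2 -> P 3 ->
  (forall n, P n -> P n.+4) -> forall n, P n.
Proof.
move=> P0 P1 P2 P3 P4 n.
suff [] : [/\ P n, P n.+1, P n.+2 & P n.+3] by [].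
by elim: n => [|n [? ? ? ?]]; split=> //; apply: P4.
Qed.

(** The group enters through an enumeration e of its 24 elements that realizes
    the multiplication table. *)
Section Resolution.
Variables (G : groupType) (s t : G) (e : nat -> G).
Hypothesis tst : (t * s * t = s * s)%g.
Hypothesis sts : (s * t * s = t * t)%g.
Hypothesis e_lmul_s : forall k, (k < 24)%N -> e (lmul_s k) = (s * e k)%g.
Hypothesis e_lmul_t : forall k, (k < 24)%N -> e (lmul_t k) = (t * e k)%g.
Hypothesis e_inj : {in gtn 24 &, injective e}.
Hypothesis e_surj : forall x, exists2 k, (k < 24)%N & x = e k.

(** The cells of the Cayley complex are the vertices x, the edges from x to s x
    and from x to t x, and for each x two faces with boundary words t s t = s s
    and s t s = t t read from x; d0 and d1 are the cellular coboundaries. *)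
Definition d0 (a : G -> int) : G -> int * int :=
  fun x => (a (s * x)%g - a x, a (t * x)%g - a x).

Definition d1 (p : G -> int * int) : G -> int * int := fun x =>
  ((p x).2 + (p (t * x)%g).1 + (p (s * (t * x))%g).2
     - (p x).1 - (p (s * x)%g).1,
   (p x).1 + (p (s * x)%g).2 + (p (t * (s * x))%g).1
     - (p x).2 - (p (t * x)%g).2).

(** The coboundary to the three-cells. Its shape is dual to that of d0, by
    Poincare duality on the 3-sphere: a face of the first type separates two
    three-cells that differ by s, and one of the second type two that differ
    by t. *)
Definition d2 (p : G -> int * int) : G -> int := fun x =>
  (p x).1 - (p (s * x)%g).1 + (p x).2 - (p (t * x)%g).2.

(** The splicing map: summation onto Z followed by the embedding of Z as the
    constant functions. *)
Definition d3 (a : G -> int) : G -> int :=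
  fun _ => \sum_(k <- iota 0 24) a (e k).

Let subfE (V : zmodType) (a b : G -> V) x : (a - b) x = a x - b x.
Proof. by []. Qed.
Let subpE (u v : int * int) : u - v = (u.1 - v.1, u.2 - v.2).
Proof. by []. Qed.

Fact d0B : zmod_morphism d0.
Proof.
move=> a b; apply/funext => x; rewrite subfE subpE /d0 !subfE /=.
by congr pair; ring.
Qed.
Fact d1B : zmod_morphism d1.
Proof.
move=> a b; apply/funext => x; rewrite subfE subpE /d1 !subfE !subpE /=.
by congr pair; ring.
Qed.
Fact d2B : zmod_morphism d2.
Proof.
move=> a b; apply/funext => x; rewrite subfE /d2 !subfE !subpE /=; ring.
Qed.
Fact d3B : zmod_morphism d3.
Proof. by move=> a b; apply/funext => x; rewrite subfE /d3 -sumrB. Qed.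
HB.instance Definition _ := GRing.isZmodMorphism.Build _ _ d0 d0B.
HB.instance Definition _ := GRing.isZmodMorphism.Build _ _ d1 d1B.
HB.instance Definition _ := GRing.isZmodMorphism.Build _ _ d2 d2B.
HB.instance Definition _ := GRing.isZmodMorphism.Build _ _ d3 d3B.

Lemma sum_bij (f : G -> G) (a : G -> int) : injective f ->
  \sum_(k <- iota 0 24) a (f (e k)) = \sum_(k <- iota 0 24) a (e k).
Proof.
move=> f_inj; rewrite -[LHS](big_map (f \o e) xpredT) -[RHS](big_map e xpredT).
have e_uniq : uniq (map e (iota 0 24)).
  rewrite map_inj_in_uniq ?iota_uniq // => k l; rewrite !mem_iota /=.
  exact: e_inj.
apply: perm_big; rewrite map_comp.
have fe_uniq : uniq (map f (map e (iota 0 24))) by rewrite map_inj_uniq.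
apply: uniq_perm => //.
have fe_sub : {subset map f (map e (iota 0 24)) <= map e (iota 0 24)}.
  by move=> x _; have [k k24 ->] := e_surj x; rewrite map_f ?mem_iota.
by have [|_ ee] := uniq_min_size fe_uniq fe_sub; rewrite ?size_map.
Qed.

Lemma d0G : equivariant d0.
Proof. by move=> c a; apply/funext => x; rewrite /translate /d0 !mulgA. Qed.
Lemma d1G : equivariant d1.
Proof. by move=> c a; apply/funext => x; rewrite /translate /d1 !mulgA. Qed.
Lemma d2G : equivariant d2.
Proof. by move=> c a; apply/funext => x; rewrite /translate /d2 !mulgA. Qed.
Lemma d3G : equivariant d3.
Proof.
move=> c a; apply/funext => x.
exact: (@sum_bij (fun y => y * c)%g a (mulIg c)).
Qed.

Lemma d1d0 a : d1 (d0 a) = 0.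
Proof.
apply/funext => x; rewrite /d1 /d0 /= -[RHS]/((0, 0) : int * int).
by rewrite !mulgA tst sts; congr pair; ring.
Qed.
Lemma d2d1 p : d2 (d1 p) = 0.
Proof.
apply/funext => x; rewrite /d2 /d1 /= -[RHS]/(0 : int) !mulgA.
by rewrite tst sts; ring.
Qed.
Lemma d3d2 p : d3 (d2 p) = 0.
Proof.
apply/funext => x; rewrite /d3 /d2 /= -[RHS]/(0 : int).
rewrite !sumrB big_split sumrB /=.
rewrite (@sum_bij (fun y => s * y)%g (fun y => (p y).1) (mulgI s)).
rewrite (@sum_bij (fun y => t * y)%g (fun y => (p y).2) (mulgI t)); ring.
Qed.
Lemma d0d3 a : d0 (d3 a) = 0.
Proof. by apply/funext => x; rewrite /d0 /d3 !subrr. Qed.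

Definition index_of (x : G) := index x (map e (iota 0 24)).
Definition of_values1 (u : nat -> int) : G -> int := fun x => u (index_of x).
Definition of_values2 (u : nat -> int) : G -> int * int :=
  fun x => (u (index_of x), u (24 + index_of x)%N).
Definition values1 (a : G -> int) c := a (e (c %% 24)).
Definition values2 (p : G -> int * int) c :=
  if (c < 24)%N then (p (e (c %% 24))).1 else (p (e (c %% 24))).2.

Lemma index_ofK k : (k < 24)%N -> index_of (e k) = k.
Proof.
move=> k24; have ek : e k = nth 1%g (map e (iota 0 24)) k.
  by rewrite (nth_map 0%N) ?size_iota // nth_iota.
rewrite /index_of {1}ek index_uniq ?size_map //.
rewrite map_inj_in_uniq ?iota_uniq // => i j; rewrite !mem_iota /=.
exact: e_inj.
Qed.

Lemma values1_inj a b :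
  (forall k, (k < 24)%N -> values1 a k = values1 b k) -> a = b.
Proof.
move=> ab; apply/funext => x; have [k k24 ->] := e_surj x.
by have := ab k k24; rewrite /values1 modn_small.
Qed.

Lemma values2_inj p r :
  (forall k, (k < 48)%N -> values2 p k = values2 r k) -> p = r.
Proof.
move=> pr; apply/funext => x; have [k k24 ->] := e_surj x.
have := pr k (leq_trans k24 (isT : 24 <= 48)%N); have := pr (24 + k)%N.
rewrite /values2 ltn_add2l k24 => /(_ isT); rewrite modnDl modn_small //=.
by case: (p _) (r _) => [? ?] [? ?] /= -> ->.
Qed.

Lemma values1K a : of_values1 (values1 a) = a.
Proof.
apply: values1_inj => k k24; rewrite {1}/values1 /of_values1 modn_small //.
by rewrite index_ofK.
Qed.

Lemma values2K p : of_values2 (values2 p) = p.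
Proof.
apply/funext => x; have [k k24 ->] := e_surj x.
rewrite /of_values2 index_ofK // /values2 k24 /= modnDl modn_small //.
by case: (p _).
Qed.

Lemma lmul_s_lt k : (k < 24)%N -> (lmul_s k < 24)%N.
Proof.
have /allP ok : all (fun k => lmul_s k < 24)%N (iota 0 24) by vm_compute.
by move=> k24; apply: ok; rewrite mem_iota.
Qed.

Lemma lmul_t_lt k : (k < 24)%N -> (lmul_t k < 24)%N.
Proof.
have /allP ok : all (fun k => lmul_t k < 24)%N (iota 0 24) by vm_compute.
by move=> k24; apply: ok; rewrite mem_iota.
Qed.

Lemma eval_row0 u c : eval (row0 c) u = values2 (d0 (of_values1 u)) c.
Proof.
rewrite /row0 /values2 /d0 /of_values1 /=; set k := (c %% 24)%N.
have k24 : (k < 24)%N by rewrite ltn_mod.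
rewrite -e_lmul_s // -e_lmul_t // !index_ofK ?lmul_s_lt ?lmul_t_lt //.
by rewrite /eval; case: ifP => _; rewrite !big_cons big_nil /=; ring.
Qed.

Lemma eval_row1 u c : eval (row1 c) u = values2 (d1 (of_values2 u)) c.
Proof.
rewrite /row1 /values2 /d1 /of_values2 /=; set k := (c %% 24)%N.
have k24 : (k < 24)%N by rewrite ltn_mod.
rewrite -e_lmul_s // -e_lmul_t // -e_lmul_s ?lmul_t_lt //.
rewrite -e_lmul_t ?lmul_s_lt //.
rewrite !index_ofK ?lmul_s_lt ?lmul_t_lt ?lmul_s_lt //.
by rewrite /eval; case: ifP => _; rewrite !big_cons big_nil /=; ring.
Qed.

Lemma eval_row2 u c : eval (row2 c) u = values1 (d2 (of_values2 u)) c.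
Proof.
rewrite /row2 /values1 /d2 /of_values2 /=; set k := (c %% 24)%N.
have k24 : (k < 24)%N by rewrite ltn_mod.
rewrite -e_lmul_s // -e_lmul_t // !index_ofK ?lmul_s_lt ?lmul_t_lt //.
by rewrite /eval !big_cons big_nil /=; ring.
Qed.

Lemma eval_row3 u c : eval (row3 c) u = d3 (of_values1 u) 1%g.
Proof.
rewrite /eval big_map /d3; apply: eq_big_seq => k; rewrite mem_iota /= => k24.
by rewrite mul1r /of_values1 index_ofK.
Qed.

Lemma exact_d0 a : d0 a = 0 -> exists m, a = fun _ => m.
Proof.
move=> a0; have v0 i : eval (row0 i) (values1 a) = 0.
  by rewrite eval_row0 values1K a0 /values2 if_same.
exists (values1 a 0); apply: values1_inj => k k24.
rewrite -(homotopy_eval homotopy_check0 v0 k24) /eval !big_seq1 !mul1r.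
by rewrite /values1.
Qed.

Lemma exact_d1 p : d1 p = 0 -> exists a, p = d0 a.
Proof.
move=> p0; have v0 i : eval (row1 i) (values2 p) = 0.
  by rewrite eval_row1 values2K p0 /values2 if_same.
exists (of_values1 (fun i => eval (homotopy1 i) (values2 p))).
apply: values2_inj => k k48; rewrite -eval_row0.
by rewrite (homotopy_eval homotopy_check1 v0).
Qed.

Lemma exact_d2 p : d2 p = 0 -> exists r, p = d1 r.
Proof.
move=> p0; have v0 i : eval (row2 i) (values2 p) = 0.
  by rewrite eval_row2 values2K p0.
exists (of_values2 (fun i => eval (homotopy2 i) (values2 p))).
apply: values2_inj => k k48; rewrite -eval_row1.
by rewrite (homotopy_eval homotopy_check2 v0).
Qed.

Lemma exact_d3 a : d3 a = 0 -> exists p, a = d2 p.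
Proof.
move=> a0; have v0 i : eval (row3 i) (values1 a) = 0.
  by rewrite eval_row3 values1K a0.
exists (of_values2 (fun i => eval (homotopy3 i) (values1 a))).
apply: values1_inj => k k24; rewrite -eval_row2.
by rewrite (homotopy_eval homotopy_check3 v0).
Qed.

Lemma const_d3 m : exists a, (fun _ => m) = d3 a.
Proof.
exists (of_values1 (fun i => if i == 0%N then m else 0)).
apply/funext => x; rewrite /d3.
transitivity (\sum_(k <- iota 0 24) if k == 0%N then m else 0).
  by rewrite /= !big_cons big_nil /= !addr0.
apply: eq_big_seq => k; rewrite mem_iota => k24.
by rewrite /of_values1 index_ofK.
Qed.

Fixpoint tet_obj (n : nat) : zmodType :=
  match n with
  | 0 => int
  | 1 | 2 => (int * int)%type
  | 3 => int
  | n'.+4 => tet_obj n'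
  end.

Fixpoint tet_diff n : {additive (G -> tet_obj n) -> (G -> tet_obj n.+1)} :=
  match n with
  | 0 => d0 | 1 => d1 | 2 => d2 | 3 => d3
  | n'.+4 => tet_diff n'
  end.

Lemma tet_diffG n : equivariant (tet_diff n).
Proof.
elim/nat_ind4: n => [||||n IH].
- exact: d0G.
- exact: d1G.
- exact: d2G.
- exact: d3G.
- exact: IH.
Qed.

Lemma tet_diffK n a : tet_diff n.+1 (tet_diff n a) = 0.
Proof.
elim/nat_ind4: n a => [||||n IH] a.
- exact: d1d0.
- exact: d2d1.
- exact: d3d2.
- exact: d0d3.
- exact: IH.
Qed.

Lemma tet_diff_exact n a : tet_diff n.+1 a = 0 -> exists b, a = tet_diff n b.
Proof.
elim/nat_ind4: n a => [||||n IH] a.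
- exact: exact_d1.
- exact: exact_d2.
- exact: exact_d3.
- by case/exact_d0 => m ->; exact: const_d3.
- exact: IH.
Qed.

Definition tet_complex : coind_complex G :=
  @CoindComplex G tet_obj tet_diff tet_diffG tet_diffK tet_diff_exact.

Lemma tet_complex_const (a : G -> obj tet_complex 0) :
  diff tet_complex 0 a = 0 <-> exists m, a = fun _ => m.
Proof.
split=> [|[m ->]]; first exact: exact_d0.
by apply/funext => x; rewrite /= /d0 !subrr.
Qed.

Definition tet_cohomology_group (q : nat) : zmodType :=
  if (q == 0)%N then (int : zmodType)
  else if (q %% 4 == 0)%N then ('Z_24 : zmodType)
  else if (q %% 4 == 2)%N then ('Z_3 : zmodType)
  else ('I_1 : zmodType).

(** The complex of invariants has cohomology W in degree n. *)
Definition const_cohomology (n : nat) (W : zmodType) : Prop :=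
  exists2 theta : {additive obj tet_complex n -> W},
  (forall v, const_map (diff tet_complex n) v = 0 ->
     theta v = 0 <-> const_boundary v) &
  (forall w, exists2 v, const_map (diff tet_complex n) v = 0 & theta v = w).

Lemma const_map_d0 m : const_map d0 m = 0.
Proof. by rewrite /const_map /d0 !subrr. Qed.
Lemma const_map_d1 u : const_map d1 u = (2 * u.2 - u.1, 2 * u.1 - u.2).
Proof. by rewrite /const_map /d1; congr pair; ring. Qed.
Lemma const_map_d2 u : const_map d2 u = 0.
Proof. by rewrite /const_map /d2; ring. Qed.
Lemma const_map_d3 m : const_map d3 m = 24 * m.
Proof. by rewrite /const_map /d3 big_const_seq /=; ring. Qed.

Lemma const_cohomology0 : const_cohomology 0 int.
Proof.
exists idfun => [v _ //|w]; exists w => //; exact: const_map_d0.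
Qed.

Lemma const_cohomology1 : const_cohomology 1 'I_1.
Proof.
exists \0 => [v|w]; last by exists 0; rewrite ?raddf0 // [w]ord1.
rewrite /= const_map_d1 => -[v1 v2]; split=> // _; exists 0.
rewrite [RHS]const_map_d0; case: v v1 v2 => a b /= v1 v2.
by congr pair; lia.
Qed.

Lemma intr_Zp_eq0 n (m : int) : (1 < n)%N ->
  m%:~R = 0 :> 'Z_n <-> (n %| m)%Z.
Proof.
move=> n1; rewrite dvdzE -[X in `|X|%N]/(n%:Z) absz_nat.
have nat0 k : k%:R = 0 :> 'Z_n <-> (n %| k)%N.
  split=> [/(congr1 val)|nk]; first by rewrite /= val_Zp_nat // => /eqP.
  by apply: val_inj; rewrite /= val_Zp_nat //; apply/eqP.
case: m => k; rewrite ?NegzE ?abszN ?absz_nat; first exact: nat0.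
rewrite mulrNz -pmulrn; split=> [/eqP|/nat0 ->]; last exact: oppr0.
by rewrite oppr_eq0 => /eqP/nat0.
Qed.

Lemma const_cohomology2 : const_cohomology 2 'Z_3.
Proof.
pose f (v : int * int) : 'Z_3 := (v.1 - v.2)%:~R.
have fB : zmod_morphism f.
  move=> u v; rewrite /f -rmorphB /=; congr _%:~R => /=; ring.
pose fA := GRing.isZmodMorphism.Build _ _ f fB.
exists (HB.pack f fA : {additive _ -> _}) => [[a b] _|w] /=.
  rewrite /f /= intr_Zp_eq0 //; split=> [/dvdzP[m ab]|[[u v]]].
    (* The preimage under const_map d1 of a pair with a - b = 3 m. *)
    by exists (a - 2 * m, a - m); rewrite const_map_d1; congr pair => /=; lia.
  rewrite const_map_d1 => -[-> ->] /=; apply/dvdzP; exists (v - u); lia.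
exists ((w : nat)%:Z, 0); first exact: const_map_d2.
by rewrite /f /= subr0 -pmulrn natr_Zp.
Qed.

Lemma const_cohomology3 : const_cohomology 3 'I_1.
Proof.
exists \0 => [v|w]; last by exists 0; rewrite ?raddf0 // [w]ord1.
rewrite /= const_map_d3 => v0; split=> // _; exists 0.
rewrite [RHS]const_map_d2; lia.
Qed.

Lemma const_cohomology4 : const_cohomology 4 'Z_24.
Proof.
exists (intmul 1 : {additive _ -> _}) => [m _|w] /=.
  rewrite intr_Zp_eq0 //; split=> [/dvdzP[u ->]|[u ->]].
    by exists u; rewrite const_map_d3 mulrC.
  by rewrite const_map_d3 dvdz_mulr.
exists (w : nat)%:Z; first exact: const_map_d0.
by rewrite -pmulrn natr_Zp.
Qed.

Lemma tet_cohomology q :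
  zmod_isog (cohomology G int q) (tet_cohomology_group q).
Proof.
suff [theta t0 tsurj] : const_cohomology q (tet_cohomology_group q).
  exact: (cohomology_isog tet_complex_const t0 tsurj).
case: q => [|n]; first exact: const_cohomology0.
elim/nat_ind4: n => [||||n IH].
- exact: const_cohomology1.
- exact: const_cohomology2.
- exact: const_cohomology3.
- exact: const_cohomology4.
- suff -> : tet_cohomology_group n.+1.+4 = tet_cohomology_group n.+1 by [].
  by rewrite /tet_cohomology_group -[n.+1.+4]/(4 + n.+1)%N modnDl.
Qed.

End Resolution.

(** * The binary tetrahedral group *)

Section Identification.
Variable R : realType.
Notation T := (binary_tetrahedral R).

Definition quat_of_hurwitz (x : hurwitz) : quaternion R :=
  let: (a, b, c, d) := x in
  Quat (a%:~R / 2) (b%:~R / 2) (c%:~R / 2) (d%:~R / 2).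

Lemma generated_in (a : unit_quaternion R) :
  [set uqi R; uqomega R]%classic a ->
  a \in generated [set uqi R; uqomega R]%classic.
Proof. by move=> Aa; apply/asboolP => H _ AH; exact: AH. Qed.

Definition tet_i : T := GeneratedSubgroup (generated_in (or_introl erefl)).
Definition tet_w : T := GeneratedSubgroup (generated_in (or_intror erefl)).

Definition quat_val (x : T) : quaternion R := val (val x).

Lemma quat_valM (x y : T) : quat_val (x * y)%g = qmul (quat_val x) (quat_val y).
Proof. by []. Qed.
Lemma quat_val_inj : injective quat_val.
Proof. by move=> x y /val_inj/val_inj. Qed.

(** As quaternions, s = - omega^-1 and t = i s^-1, so that i = t s and
    omega = s s. *)
Definition tet_s : T := (tet_i * tet_i * tet_w^-1)%g.
Definition tet_t : T := (tet_i * tet_s^-1)%g.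

Lemma quat_val_s : quat_val tet_s = quat_of_hurwitz (hgen false).
Proof. by rewrite /tet_s /quat_val /=; congr Quat; rewrite ?mulrNz; field. Qed.
Lemma quat_val_t : quat_val tet_t = quat_of_hurwitz (hgen true).
Proof.
by rewrite /tet_t /tet_s /quat_val /=; congr Quat; rewrite ?mulrNz; field.
Qed.

Lemma tet_i_ts : tet_i = (tet_t * tet_s)%g.
Proof. by rewrite /tet_t mulgVK. Qed.
Lemma tet_w_ss : tet_w = (tet_s * tet_s)%g.
Proof.
by apply: quat_val_inj; rewrite /tet_s /quat_val /=; congr Quat; field.
Qed.

(** Induction with the generators s and t in place of i and omega. *)
Lemma tet_ind (H : {pred T}) : group_closed H -> tet_s \in H -> tet_t \in H ->
  forall x, x \in H.
Proof.
move=> clH Hs Ht x; have [H1 HB] := clH; have HM := group_closedM clH.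
pose K : {pred unit_quaternion R} :=
  fun u => `[< exists2 y : T, u = val y & y \in H >].
have clK : group_closed K.
  split=> [|_ _ /asboolP[y -> Hy] /asboolP[z -> Hz]]; apply/asboolP.
    by exists 1%g.
  by exists (y / z)%g; [|exact: HB].
have AK a : [set uqi R; uqomega R]%classic a -> a \in K.
  move=> [->|->]; apply/asboolP.
    by exists tet_i => //; rewrite tet_i_ts HM.
  by exists tet_w => //; rewrite tet_w_ss HM.
case: x => u uA; have /asboolP/(_ K clK AK)/asboolP[y uy Hy] := uA.
by rewrite (_ : GeneratedSubgroup uA = y) //; exact: val_inj.
Qed.

Definition tet_word (w : seq bool) : T :=
  foldr (fun b x => (if b then tet_t else tet_s) * x)%g 1%g w.

Definition elt k : T := tet_word (word k).

Lemma quat_of_hurwitzM x y z : hprod x y == hdouble z ->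
  qmul (quat_of_hurwitz x) (quat_of_hurwitz y) = quat_of_hurwitz z.
Proof.
case: x y z => [[[a b] c] d] [[[a' b'] c'] d'] [[[p q] r] s] /eqP[].
have half (u v : int) : u = 2 * v -> v%:~R / 2 = u%:~R / 4 :> R.
  by move=> ->; rewrite intrM; field.
move=> /half p2 /half q2 /half r2 /half s2; rewrite /= p2 q2 r2 s2.
by congr Quat; field.
Qed.

(** All the halvings in the evaluation of the word are exact. *)
Fixpoint word_ok (w : seq bool) :=
  if w is b :: w' then
    (hprod (hgen b) (hword w') == hdouble (hword w)) && word_ok w' else true.

Lemma quat_val_gword w : word_ok w ->
  quat_val (tet_word w) = quat_of_hurwitz (hword w).
Proof.
elim: w => [_|b w IH /andP[bw wok]] /=; first by congr Quat; field.
rewrite quat_valM IH // -(quat_of_hurwitzM bw).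
by case: b {bw}; rewrite ?quat_val_s ?quat_val_t.
Qed.

Lemma quat_val_elt k : (k < 24)%N ->
  quat_val (elt k) = quat_of_hurwitz (hurwitz_elt k).
Proof.
have /allP ok : all (fun k => word_ok (word k)) (iota 0 24) by vm_compute.
by move=> k24; apply: quat_val_gword; apply: ok; rewrite mem_iota.
Qed.

Lemma quat_of_hurwitz_inj : injective quat_of_hurwitz.
Proof.
have half (u v : int) : u%:~R / 2 = v%:~R / 2 :> R -> u = v.
  by move/mulIf => uv; apply/(@intr_inj R)/uv; rewrite invr_eq0 pnatr_eq0.
by move=> [[[a b] c] d] [[[a' b'] c'] d'] [] /half-> /half-> /half-> /half->.
Qed.

Lemma elt_lmul_s k : (k < 24)%N -> elt (lmul_s k) = (tet_s * elt k)%g.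
Proof.
have /allP ok : all (fun k =>
    hprod (hgen false) (hurwitz_elt k) == hdouble (hurwitz_elt (lmul_s k)))
    (iota 0 24).
  by vm_compute.
move=> k24; apply: quat_val_inj.
rewrite quat_valM !quat_val_elt ?lmul_s_lt // quat_val_s.
by rewrite (quat_of_hurwitzM (ok k _)) ?mem_iota.
Qed.

Lemma elt_lmul_t k : (k < 24)%N -> elt (lmul_t k) = (tet_t * elt k)%g.
Proof.
have /allP ok : all (fun k =>
    hprod (hgen true) (hurwitz_elt k) == hdouble (hurwitz_elt (lmul_t k)))
    (iota 0 24).
  by vm_compute.
move=> k24; apply: quat_val_inj.
rewrite quat_valM !quat_val_elt ?lmul_t_lt // quat_val_t.
by rewrite (quat_of_hurwitzM (ok k _)) ?mem_iota.
Qed.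

Lemma elt_inj : {in gtn 24 &, injective elt}.
Proof.
move=> k l k24 l24 /(congr1 quat_val); rewrite !quat_val_elt //.
move/quat_of_hurwitz_inj => kl.
have /allP ok :
    all (fun k => index (hurwitz_elt k) hurwitz_elts == k) (iota 0 24).
  by vm_compute.
by rewrite -(eqP (ok k _)) ?mem_iota // kl (eqP (ok l _)) ?mem_iota.
Qed.

(** The set of listed elements contains 1 and is stable under left
    multiplication by s, t and their inverses, hence is everything; s and t have
    order 6, so that their inverses are their fifth powers. *)
Lemma elt_surj x : exists2 k, (k < 24)%N & x = elt k.
Proof.
pose E (y : T) := exists2 k, (k < 24)%N & y = elt k.
pose H : {pred T} := fun x =>
  `[< (forall y, E y -> E (x * y)%g) /\ (forall y, E y -> E (x^-1 * y)%g) >].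
have H_gen (f : nat -> nat) g : (forall k, (k < 24)%N -> (f k < 24)%N) ->
    (forall k, (k < 24)%N -> elt (f k) = (g * elt k)%g) ->
    all (fun k => f (iter 5 f k) == k) (iota 0 24) -> g \in H.
  move=> f24 fg /allP f6; apply/asboolP; split=> _ [k k24 ->].
    by exists (f k); rewrite ?f24 ?fg.
  have k5 : (iter 5 f k < 24)%N by rewrite /= !f24.
  exists (iter 5 f k) => //; rewrite -{1}(eqP (f6 k _)) ?mem_iota //.
  by rewrite fg // mulKg.
have Hx : x \in H.
  apply: tet_ind; last 2 first.
  - by apply: H_gen lmul_s_lt elt_lmul_s _; vm_compute.
  - by apply: H_gen lmul_t_lt elt_lmul_t _; vm_compute.
  split=> [|y z /asboolP[Ey EVy] /asboolP[Ez EVz]]; apply/asboolP.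
    by split=> y; rewrite ?invg1 mul1g.
  by split=> w Ew; rewrite ?invgM ?invgK -mulgA; auto.
have /asboolP[/(_ 1%g) Ex _] := Hx.
by rewrite mulg1 in Ex; apply: Ex; exists 0%N.
Qed.

(** The relations are read off the multiplication table. *)
Lemma tet_tst : (tet_t * tet_s * tet_t = tet_s * tet_s)%g.
Proof.
apply: (mulIg (elt 0)); transitivity (elt 2).
  rewrite -(mulgA (tet_t * tet_s)%g) -(mulgA tet_t).
  by rewrite -elt_lmul_t // -elt_lmul_s // -elt_lmul_t.
by rewrite -(mulgA tet_s) -!elt_lmul_s.
Qed.

Lemma tet_sts : (tet_s * tet_t * tet_s = tet_t * tet_t)%g.
Proof.
apply: (mulIg (elt 0)); transitivity (elt 13).
  rewrite -(mulgA (tet_s * tet_t)%g) -(mulgA tet_s).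
  by rewrite -elt_lmul_s // -elt_lmul_t // -elt_lmul_s.
by rewrite -(mulgA tet_t) -!elt_lmul_t.
Qed.

End Identification.

Local Close Scope ring_scope.

Theorem corollary6p3p3 (R : realType) (q : nat) :
  let H := cohomology (binary_tetrahedral R) int q in
  if q == 0%N then zmod_isog H int
  else if q %% 4 == 0%N then zmod_isog H 'Z_24
  else if q %% 4 == 2 then zmod_isog H 'Z_3
  else zmod_isog H 'I_1.
Proof.
have := tet_cohomology (@tet_tst R) (@tet_sts R) (@elt_lmul_s R) (@elt_lmul_t R)
  (@elt_inj R) (@elt_surj R) q.
rewrite /tet_cohomology_group; case: (q == 0)%N => //; case: (_ == 0)%N => //.
by case: (_ == 2)%N.
Qed.
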